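(* Let $G_1, G_2:\mathbb{R}\to[0,1]$ be right-continuous, monotone non-decreasing functions with $\lim_{x\to-\infty}G_i(x)=0$ and $\lim_{x\to\infty}G_i(x)=1$, and suppose $G_i(x)=1-G_i(-x)$ for all $x\in\mathbb{R}$, $i=1,2$. Then for every $a>0$, $$\mathbf{G}=\int_{-a}^{a}\int_{-1/a}^{1/a}\frac{G_1(x_1)\,G_2(x_2)}{1+x_1^2x_2^2}\,dx_1\,dx_2,$$ where $\mathbf{G}=\sum_{n=0}^{\infty}\frac{(-1)^n}{(2n+1)^2}$ is Catalan's constant.
   Context: Catalan's constant is $\mathbf{G}=\sum_{n=0}^{\infty}\frac{(-1)^n}{(2n+1)^2}\approx 0.915965$. *)

(* Defs.v *)
From mathcomp Require Import all_boot all_order all_algebra.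
From mathcomp Require Import all_classical all_reals all_analysis.
From mathcomp Require Import ring zify.

Set Implicit Arguments.
Unset Strict Implicit.
Unset Printing Implicit Defensive.

Import Order.TTheory GRing.Theory Num.Theory.
Import numFieldNormedType.Exports.

Local Open Scope classical_set_scope.
Local Open Scope ring_scope.

Definition catalan_term (R : realType) : R^nat :=
  fun n => (-1) ^+ n / (2 * n + 1)%:R ^+ 2.

Definition catalan (R : realType) : R := limn (series (@catalan_term R)).

(* [limn] is unspecified on divergent sequences, so this lemma is what makes
   [catalan] the sum of the series. *)
Lemma is_cvg_series_catalan_term (R : realType) :
  cvgn (series (@catalan_term R)).
Proof.
apply: normed_cvg.
pose f : R^nat := fun n => - (2 * n.+1%:R^-1).
have f_cvg : cvgn f.
  apply: is_cvgN; apply: is_cvgM; first exact: is_cvg_cst.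
  by apply/cvg_ex; exists 0; exact: (@cvg_harmonic R).
apply: (@series_le_cvg R _ (telescope f)).
- by move=> n; rewrite normr_ge0.
- move=> n; rewrite /telescope /f /= opprK addrC subr_ge0.
  by rewrite ler_pM2l// lef_pV2 ?posrE// ler_nat.
- move=> n; rewrite /catalan_term /= normrM normrX normrN1 expr1n mul1r.
  rewrite normfV normrX normr_nat /telescope /f /= opprK addrC -mulrBr.
  have -> : 2 * (n.+1%:R^-1 - n.+2%:R^-1) = 2 / (n.+1%:R * n.+2%:R) :> R.
    have n1 : n.+1%:R != 0 :> R by rewrite pnatr_eq0.
    have n2 : n.+1%:R + 1 != 0 :> R by rewrite natr1 pnatr_eq0.
    rewrite -(@natr1 R n.+1); move: n.+1%:R n1 n2 => x x0 x1.
    by field; rewrite x0 x1.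
  rewrite -[leLHS]mul1r ler_pdivrMr ?exprn_gt0 ?ltr0n ?addn1//.
  rewrite mulrAC ler_pdivlMr ?mulr_gt0 ?ltr0n// mul1r.
  rewrite -natrM -natrX -natrM ler_nat; nia.
- rewrite telescopeK; apply: is_cvgB => //; exact: is_cvg_cst.
Qed.

(* Main.v *)
Require Import Defs.
From mathcomp Require Import all_boot all_order all_algebra.
From mathcomp Require Import all_classical all_reals all_analysis.
From mathcomp Require Import measurable_realfun ring lra zify.

Set Implicit Arguments.
Unset Strict Implicit.
Unset Printing Implicit Defensive.

Import Order.TTheory GRing.Theory Num.Theory.
Import numFieldNormedType.Exports.

Local Open Scope classical_set_scope.
Local Open Scope ring_scope.

(* A weight with [G x + G (- x) = 1] disappears from the integral of [G * h] over
   [[-b, b]] when [h] is even: folding at 0 leaves the integral of [h] over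
   [[0, b]]. Doing this in both variables leaves the integral of
   1 / (1 + x^2 y^2) over [[0, 1/a] x [0, a]]. There [x y] ranges over [[0, 1]],
   so the kernel lies between consecutive partial sums of its alternating
   geometric series; since (1/a) a = 1, these integrate to the partial sums of
   Catalan's series. *)

(** * Reflection at 0 and complementary weights *)

Section complementary_weight.
Context {R : realType}.
Local Open Scope ereal_scope.
Notation mu := (@lebesgue_measure R).

(** Lebesgue measure is its own pushforward under negation. *)
Lemma ge0_integral_itvN (f : R -> \bar R) (a b : R) :
  measurable_fun [set: R] f -> (forall x, 0 <= f x) ->
  \int[mu]_(x in `[(- b)%R, (- a)%R]) f x = \int[mu]_(x in `[a, b]) f (- x)%R.
Proof.
move=> mf f0; rewrite (_ : `[a, b]%classic =
    (-%R : _ -> measurableTypeR R) @^-1` `[(- b)%R, (- a)%R]); last first.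
  by rewrite opp_preimage_itvbndbnd !opprK.
rewrite -ge0_integral_pushforward//=; last exact: measurable_funS mf.
by apply: eq_measure_integral => //= A mA AS; exact/esym/lebesgue_measureN.
Qed.

(** Reflecting the part over negative [x] puts the weight [G (- x)] on [h x], which adds up with
    [G x] to 1. Extended real values for [h] allow it to be itself an integral, as in the outer
    variable. *)
Lemma ge0_integral_complementary (G : R -> R) (h : R -> \bar R) (b : R) :
  measurable_fun [set: R] G -> (forall x, 0 <= G x <= 1)%R ->
  (forall x, G x = 1 - G (- x))%R ->
  measurable_fun [set: R] h -> (forall x, 0 <= h x) ->
  (forall x, h (- x)%R = h x) -> (0 <= b)%R ->
  \int[mu]_(x in `[(- b)%R, b]) ((G x)%:E * h x) = \int[mu]_(x in `[0%R, b]) h x.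
Proof.
move=> mG G01 Gsym mh h0 hN b0.
pose f x := (G x)%:E * h x.
have mf : measurable_fun [set: R] f.
  by apply: emeasurable_funM => //; exact/measurable_EFinP.
have f0 x : 0 <= f x.
  by rewrite mule_ge0// lee_fin; case/andP: (G01 x).
have mfN : measurable_fun [set: R] (fun x => f (- x)%R).
  by apply: measurableT_comp => //; exact: oppr_measurable.
rewrite (@itv_bndbnd_setU _ _ _ (BLeft 0%R)) ?bnd_simp ?oppr_le0//.
rewrite ge0_integral_setU//; last 3 first.
  exact: (@measurable_funTS _ _ _ _ _ f).
  by move=> x _; exact: f0.
  apply/disj_setPS => x [] /=; rewrite !in_itv/= => /andP[_ x0] /andP[].
  by rewrite leNgt x0.
(* The point 0 is null, so the left half may be closed; with 0 written as [- 0] it is the reflection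
   of [[0, b]]. *)
rewrite (@integral_itv_bndo_bndc _ _ _ f); last exact: measurable_funTS.
rewrite -[X in `[_, X]]oppr0 ge0_integral_itvN//.
rewrite -[X in _ + X]/(\int[mu]_(x in `[0%R, b]) f x).
rewrite -ge0_integralD//; [|exact: (measurable_funTS mfN)|exact: (measurable_funTS mf)].
apply: eq_integral => x _; rewrite /f hN -ge0_muleDl ?lee_fin//.
- by rewrite -EFinD [in X in X * _](Gsym x) addrC subrK mul1e.
- by case/andP: (G01 (- x)%R).
- by case/andP: (G01 x).
Qed.

End complementary_weight.

(** * Measurability and sign of the kernel *)

(* The kernel [(1 + (x * y) ^+ 2)^-1] is [oneDsqr\^-1] at [x * y], up to conversion. *)
Section kernel.
Context {R : realType}.
Notation mu := (@lebesgue_measure R).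

Lemma measurable_kernel (y : R) :
  measurable_fun [set: R] (fun x => (1 + (x * y) ^+ 2)^-1).
Proof.
apply: (measurableT_comp (continuous_measurable_fun (@continuous_oneDsqrV R))).
exact: mulrr_measurable.
Qed.

Lemma kernel_ge0 (t : R) : 0 <= (1 + t ^+ 2)^-1.
Proof. by rewrite invr_ge0 addr_ge0// sqr_ge0. Qed.

(** Tonelli's theorem gives measurability in [y] once the inner integral is read as a section
    integral of the kernel cut off to the strip where [x] lies in [[0, b]]. In the pair [z], [z.1]
    is [y] and [z.2] is [x]. *)
Lemma measurable_integral_kernel (b : R) : measurable_fun [set: R]
  (fun y => \int[mu]_(x in `[0%R, b]) ((1 + (x * y) ^+ 2)^-1)%:E)%E.
Proof.
pose f (z : R * R) : \bar R :=
  ((fun z : R * R => ((1 + (z.2 * z.1) ^+ 2)^-1)%:E) \_ ([set: R] `*` `[0, b])) z.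
rewrite (_ : (fun y => _) = fubini_F mu f); last first.
  apply/funext => y; rewrite /fubini_F [LHS]integral_mkcond.
  apply: eq_integral => x _.
  rewrite /f !patchE; congr (if _ then _ else _).
  by apply/idP/idP; rewrite !inE/= => // -[].
apply: measurable_fun_fubini_tonelli_F.
  apply/(measurable_restrictT _ _).1; first exact: measurableX.
  apply: measurable_funTS; apply/measurable_EFinP.
  apply: (measurableT_comp (continuous_measurable_fun (@continuous_oneDsqrV R))).
  by apply: measurable_funM.
by move=> z; rewrite /f patchE; case: ifP => // _; rewrite lee_fin kernel_ge0.
Qed.

End kernel.

(** * Exact integration of even polynomials *)

Section poly.
Context {R : realType}.
Notation mu := (@lebesgue_measure R).

Lemma integral_deriv_poly (p : {poly R}) (b : R) : 0 < b ->
  (\int[mu]_(x in `[0%R, b]) (p^`().[x])%:E = (p.[b] - p.[0])%:E)%E.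
Proof.
move=> b0; rewrite EFinB; apply: continuous_FTC2 => //.
- by apply: continuous_subspaceT => x; exact: continuous_horner.
- split=> [x _||]; first exact: derivable_horner.
  + by apply: cvg_at_right_filter; exact: continuous_horner.
  + by apply: cvg_at_left_filter; exact: continuous_horner.
- by move=> x _; rewrite derive1E; apply: derive_val.
Qed.

Lemma measurable_even_poly (c : nat -> R) (n : nat) :
  measurable_fun [set: R] (fun x => \sum_(0 <= k < n) c k * x ^+ k.*2).
Proof.
by apply: measurable_sum => k; apply: measurable_funM => //; exact: measurable_funX.
Qed.

Lemma integral_even_poly (c : nat -> R) (n : nat) (b : R) : 0 < b ->
  (\int[mu]_(x in `[0%R, b]) (\sum_(0 <= k < n) c k * x ^+ k.*2)%:E =
   (\sum_(0 <= k < n) c k * b ^+ k.*2.+1 / k.*2.+1%:R)%:E)%E.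
Proof.
move=> b0.
(* The termwise antiderivative; its exponents are all odd, so it vanishes at 0. *)
pose p : {poly R} := \sum_(0 <= k < n) (c k / k.*2.+1%:R) *: 'X^(k.*2.+1).
have -> : \sum_(0 <= k < n) c k * b ^+ k.*2.+1 / k.*2.+1%:R = p.[b] - p.[0].
  rewrite /p !horner_sum [X in _ - X]big1 ?subr0 => [|k _].
    by apply: eq_bigr => k _; rewrite !hornerE mulrAC.
  by rewrite !hornerE expr0n mulr0.
rewrite -integral_deriv_poly//; apply: eq_integral => x _; congr EFin.
rewrite /p raddf_sum/= horner_sum; apply: eq_bigr => k _.
rewrite derivZ derivXn hornerZ hornerMn hornerXn /= -(mulr_natr (x ^+ k.*2)).
by rewrite [X in _ = _ * X]mulrC mulrA divfK ?pnatr_eq0.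
Qed.

End poly.

(** * Partial sums of the alternating geometric series *)

Section geometric.
Context {R : realType}.
Implicit Types (t : R) (n : nat).

Definition geom n t : R := \sum_(0 <= k < n) (-1) ^+ k * t ^+ k.*2.

(** The terms are powers of the ratio [- t ^+ 2]. *)
Lemma geomE n t : geom n t = (1 - (-1) ^+ n * t ^+ n.*2) / (1 + t ^+ 2).
Proof.
have t1 : 1 + t ^+ 2 != 0 by rewrite gt_eqF// ltr_pwDl// sqr_ge0.
apply: (canRL (mulfK t1)); rewrite /geom big_mkord.
under eq_bigr do rewrite -mul2n exprM -exprNn.
rewrite -mul2n exprM -exprNn -[RHS]opprB subrX1.
by rewrite -[RHS]mulNr opprD !opprK mulrC addrC.
Qed.

(** Monotonicity of the integral is applied with [geom] as the smaller function, which has to be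
    nonnegative. On [[0, 1]] the power subtracted in [geomE] is at most 1 in absolute value. *)
Lemma geom_ge0 n t : 0 <= t <= 1 -> 0 <= geom n t.
Proof.
move=> /andP[t0 t1]; rewrite geomE divr_ge0//; last by rewrite addr_ge0// sqr_ge0.
rewrite subr_ge0 (le_trans (ler_norm _))// normrM normrX normrN1 expr1n mul1r.
by rewrite ger0_norm ?exprn_ge0// exprn_ile1.
Qed.

(** By [geomE] the error is an even power of [t] over [1 + t ^+ 2], with a sign fixed by the parity
    of [n]. *)
Lemma geom_le_kernel n t : ~~ odd n -> geom n t <= (1 + t ^+ 2)^-1.
Proof.
move=> n0; rewrite geomE -signr_odd (negbTE n0) mul1r.
rewrite ler_piMl ?invr_ge0 ?addr_ge0 ?sqr_ge0//.
by rewrite gerBl -mul2n mulnC exprM sqr_ge0.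
Qed.

Lemma kernel_le_geom n t : odd n -> (1 + t ^+ 2)^-1 <= geom n t.
Proof.
move=> n1; rewrite geomE -signr_odd n1 mulN1r opprK.
rewrite ler_peMl ?invr_ge0 ?addr_ge0 ?sqr_ge0//.
by rewrite lerDl -mul2n mulnC exprM sqr_ge0.
Qed.

End geometric.

(** * The unweighted double integral *)

Section catalan.
Context {R : realType}.
Notation mu := (@lebesgue_measure R).

Lemma integral_geom n (b y : R) : 0 < b ->
  (\int[mu]_(x in `[0%R, b]) (geom n (x * y))%:E =
   (\sum_(0 <= k < n) ((-1) ^+ k * b ^+ k.*2.+1 / k.*2.+1%:R) * y ^+ k.*2)%:E)%E.
Proof.
move=> b0; pose c k := (-1) ^+ k * y ^+ k.*2.
transitivity (\int[mu]_(x in `[0%R, b]) (\sum_(0 <= k < n) c k * x ^+ k.*2)%:E)%E.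
  apply: eq_integral => x _; congr EFin; apply: eq_bigr => k _.
  by rewrite /c exprMn mulrAC mulrA.
rewrite integral_even_poly//; congr EFin; apply: eq_bigr => k _.
by rewrite /c; ring.
Qed.

(** Each integration contributes a factor [1 / (2k + 1)], and the endpoints combine to a power of
    [a * b = 1]. *)
Lemma integral2_geom n (a b : R) : 0 < a -> 0 < b -> a * b = 1 ->
  (\int[mu]_(y in `[0%R, a]) \int[mu]_(x in `[0%R, b]) (geom n (x * y))%:E =
   (series (@catalan_term R) n)%:E)%E.
Proof.
move=> a0 b0 ab; under eq_integral do rewrite integral_geom//.
rewrite (integral_even_poly (fun k => (-1) ^+ k * b ^+ k.*2.+1 / k.*2.+1%:R))//.
congr EFin; apply: eq_bigr => k _; rewrite /catalan_term mul2n addn1.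
transitivity ((-1) ^+ k * (a * b) ^+ k.*2.+1 / k.*2.+1%:R / k.*2.+1%:R : R).
  by rewrite exprMn; ring.
by rewrite ab expr1n mulr1 -mulrA -invfM -expr2.
Qed.

Lemma integral2_kernel (a b : R) : 0 < a -> 0 < b -> a * b = 1 ->
  (\int[mu]_(y in `[0%R, a]) \int[mu]_(x in `[0%R, b]) ((1 + (x * y) ^+ 2)^-1)%:E =
   (catalan R)%:E)%E.
Proof.
move=> a0 b0 ab; set I := (LHS).
have xy01 (x y : R) : x \in `[0, b] -> y \in `[0, a] -> 0 <= x * y <= 1.
  rewrite !in_itv/= => /andP[x0 xb] /andP[y0 ya].
  by rewrite mulr_ge0//= -ab mulrC ler_pM.
have mk y D : measurable_fun D (fun x : R => ((1 + (x * y) ^+ 2)^-1)%:E).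
  by apply: measurable_funTS; apply/measurable_EFinP; exact: measurable_kernel.
have mg n y D : measurable_fun D (fun x : R => (geom n (x * y))%:E).
  apply: measurable_funTS; apply/measurable_EFinP.
  apply: (measurableT_comp (measurable_even_poly (fun k => (-1) ^+ k) n)).
  exact: mulrr_measurable.
have mgi n D : measurable_fun D (fun y : R =>
    \int[mu]_(x in `[0%R, b]) (geom n (x * y))%:E)%E.
  under eq_fun do rewrite integral_geom//.
  apply: measurable_funTS; apply/measurable_EFinP.
  exact: (measurable_even_poly (fun k => (-1) ^+ k * b ^+ k.*2.+1 / k.*2.+1%:R)).
have Ile n : odd n -> (I <= (series (@catalan_term R) n)%:E)%E.
  move=> n1; rewrite -(integral2_geom n a0 b0 ab); apply: ge0_le_integral => //.
  - by move=> y _; apply: integral_ge0 => x _; rewrite lee_fin kernel_ge0.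
  - exact: (measurable_funTS (measurable_integral_kernel b)).
  - exact: mgi.
  - move=> y _; apply: ge0_le_integral => //.
    + by move=> x _; rewrite lee_fin kernel_ge0.
    + exact: mk.
    + exact: mg.
    + by move=> x _; rewrite lee_fin kernel_le_geom.
have leI n : ~~ odd n -> ((series (@catalan_term R) n)%:E <= I)%E.
  move=> n0; rewrite -(integral2_geom n a0 b0 ab); apply: ge0_le_integral => //.
  - by move=> y ya; apply: integral_ge0 => x xb; rewrite lee_fin geom_ge0// xy01.
  - exact: mgi.
  - exact: (measurable_funTS (measurable_integral_kernel b)).
  - move=> y ya; apply: ge0_le_integral => //.
    + by move=> x xb; rewrite lee_fin geom_ge0// xy01.
    + exact: mg.
    + exact: mk.
    + by move=> x _; rewrite lee_fin geom_le_kernel.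
(* The first partial sum, at the odd index 1, is already a finite upper bound. *)
have Ifin : I \is a fin_num.
  rewrite ge0_fin_numE; first exact: le_lt_trans (Ile 1%N isT) (ltry _).
  by apply: integral_ge0 => y _; apply: integral_ge0 => x _; rewrite lee_fin kernel_ge0.
(* [catalan] is a limit, so it suffices that the partial sums converge to [fine I]. *)
rewrite -(fineK Ifin); congr EFin; apply/esym/cvg_lim => //.
have {}Ile n : odd n -> fine I <= series (@catalan_term R) n.
  by move=> n1; rewrite -lee_fin fineK// Ile.
have {}leI n : ~~ odd n -> series (@catalan_term R) n <= fine I.
  by move=> n1; rewrite -lee_fin fineK// leI.
(* [fine I] lies between consecutive partial sums, so their gap bounds the distance to it. The crude
   bound [n + 1 <= (2n + 1)^2] makes the gap harmonic. *)
have step n : `|series (@catalan_term R) n.+1 - series (@catalan_term R) n| <= n.+1%:R^-1.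
  rewrite seriesSB /catalan_term normrM normrX normrN1 expr1n mul1r.
  rewrite ger0_norm// lef_pV2 ?posrE ?exprn_gt0 ?ltr0n ?addn1//.
  by rewrite -natrX ler_nat; nia.
apply: (@squeeze_cvgr _ _ _ _ (fun n => fine I - n.+1%:R^-1) (fun n => fine I + n.+1%:R^-1)).
- apply: nearW => n; have := step n; rewrite ler_norml => /andP[].
  set e := n.+1%:R^-1; set S1 := series _ n.+1; set S0 := series _ n => s1 s2.
  have [no|ne] := boolP (odd n).
    have := Ile n no; have := leI n.+1; rewrite /= no => /(_ isT).
    by rewrite -/S1 -/S0 => ? ?; apply/andP; split; lra.
  by have := leI n ne; have := Ile n.+1 ne; rewrite -/S1 -/S0 => ? ?; apply/andP; split; lra.
- rewrite -[X in _ --> X]subr0; apply: cvgB; first exact: cvg_cst.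
  exact: cvg_harmonic.
- rewrite -[X in _ --> X]addr0; apply: cvgD; first exact: cvg_cst.
  exact: cvg_harmonic.
Qed.

End catalan.

(** * Removal of the two weights *)

Theorem theorem1 (R : realType) (G1 G2 : R -> R)
    (G1_01 : forall x, 0 <= G1 x <= 1) (G2_01 : forall x, 0 <= G2 x <= 1)
    (G1_rc : right_continuous G1) (G2_rc : right_continuous G2)
    (G1_nd : {homo G1 : x y / x <= y}) (G2_nd : {homo G2 : x y / x <= y})
    (G1_Ny : G1 x @[x --> -oo] --> (0 : R)) (G2_Ny : G2 x @[x --> -oo] --> (0 : R))
    (G1_y : G1 x @[x --> +oo] --> (1 : R)) (G2_y : G2 x @[x --> +oo] --> (1 : R))
    (G1_sym : forall x, G1 x = 1 - G1 (- x))
    (G2_sym : forall x, G2 x = 1 - G2 (- x))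
    (a : R) (a_gt0 : 0 < a) :
  (catalan R)%:E =
  (\int[lebesgue_measure]_(x2 in `[(- a)%R, a])
     \int[lebesgue_measure]_(x1 in `[(- (1 / a))%R, (1 / a)%R])
       (G1 x1 * G2 x2 / (1 + x1 ^+ 2 * x2 ^+ 2))%:E)%E.
Proof.
have mG1 := nondecreasing_measurable measurableT G1_nd.
have mG2 := nondecreasing_measurable measurableT G2_nd.
have b_gt0 : 0 < 1 / a by rewrite divr_gt0.
rewrite -(integral2_kernel a_gt0 b_gt0); last by rewrite mulrCA divff ?mulr1 ?gt_eqF.
set h := fun y => (\int[lebesgue_measure]_(x in `[0%R, (1 / a)%R])
  ((1 + (x * y) ^+ 2)^-1)%:E)%E.
have h0 y : (0 <= h y)%E by apply: integral_ge0 => x _; rewrite lee_fin kernel_ge0.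
(* The weights are inserted into the unweighted integral: [G2] outside, against the even function
   [h], then [G1] inside for each fixed [y]. *)
rewrite -(ge0_integral_complementary mG2 G2_01 G2_sym
  (measurable_integral_kernel _) h0 _ (ltW a_gt0)); last first.
  by move=> y; apply: eq_integral => x _; rewrite mulrN sqrrN.
apply: eq_integral => y _.
have mk : measurable_fun [set: R] (fun x : R => ((1 + (x * y) ^+ 2)^-1)%:E).
  by apply/measurable_EFinP; exact: measurable_kernel.
have k0 (x : R) : (0 <= ((1 + (x * y) ^+ 2)^-1)%:E)%E by rewrite lee_fin kernel_ge0.
rewrite -(ge0_integral_complementary mG1 G1_01 G1_sym mk k0 _ (ltW b_gt0)); last first.
  by move=> x; rewrite mulNr sqrrN.
have G2y : 0 <= G2 y by case/andP: (G2_01 y).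
(* [G2 y] is constant in [x] and moves under the inner integral. *)
rewrite -ge0_integralZl_EFin//; last 2 first.
- by move=> x _; rewrite mule_ge0// lee_fin; case/andP: (G1_01 x).
- by apply: measurable_funTS; apply: emeasurable_funM => //; exact/measurable_EFinP.
apply: eq_integral => x _; rewrite -!EFinM exprMn; congr EFin; ring.
Qed.
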